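(* Let $n\ge 3$ be even and let $G$ be the torus graph on $\mathbb{Z}_n^2$ with edges $\{(i,j),(i+1,j)\}$ and $\{(i,j),(i,j+1)\}$. Let $R=\{(i,i):1\le i\le n-1\}\cup\{(i,i+\tfrac n2):1\le i\le n-1\}\subset\mathbb{Z}_n^2$. Let $K$ be the kernel of the $\frac12$-lazy simple random walk on $G$, and let $Q$ be the kernel of the Metropolis--Hastings walk associated with $G\setminus R$, assumed to be irreducible. Then every function $f:G\setminus R\to\mathbb{R}$ has an extension $\widehat f:G\to\mathbb{R}$ (i.e. $\widehat f=f$ on $G\setminus R$) such that $$\mathcal{E}_K(\widehat f,\widehat f)\le 8n^2\,\mathcal{E}_Q(f,f).$$
   Context: All coordinates are taken modulo $n$. $K(x,x)=\frac12$, $K(x,y)=\frac18$ if $x,y$ are adjacent in $G$, and $0$ otherwise; its stationary distribution is uniform on $G$. The Metropolis--Hastings walk $Q$ on $V=G\setminus R$ is given by $Q(x,y)=\frac18$ if $x,y\in V$ are adjacent in $G$, $Q(x,x)=1-\frac18\deg_V(x)$ where $\deg_V(x)$ is the number of neighbours of $x$ in $V$, and $0$ otherwise; its stationary distribution is uniform on $V$. For a kernel $P$ on a finite set $X$ with stationary distribution $\pi$, $\mathcal{E}_P(f,f)=\frac12\sum_{x,y\in X}|f(x)-f(y)|^2P(x,y)\pi(x)$. *)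

(* Defs.v *)
From HB Require Import structures.
From mathcomp Require Import all_boot all_order all_algebra.
From mathcomp Require Import reals lra.

Set Implicit Arguments.
Unset Strict Implicit.
Unset Printing Implicit Defensive.

Import Order.TTheory GRing.Theory Num.Theory.
Local Open Scope ring_scope.

Section Kernels.
Variables (R : realType) (X : finType).
Implicit Types (P : X -> X -> R) (pi f : X -> R).

Definition unif : X -> R := fun=> #|X|%:R^-1.

Fixpoint kpow P (k : nat) (x y : X) : R :=
  if k is k'.+1 then \sum_(z : X) P x z * kpow P k' z y else (x == y)%:R.

Definition irreducible_kernel P : Prop :=
  forall x y : X, exists k : nat, 0 < kpow P k x y.

Definition stochastic P : Prop :=
  (forall x y, 0 <= P x y) /\ (forall x, \sum_y P x y = 1).

Definition stationary P pi : Prop :=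
  [/\ forall x, 0 <= pi x, \sum_x pi x = 1
    & forall y, \sum_x pi x * P x y = pi y].

Definition dirichlet P pi f : R :=
  1 / 2 * \sum_(x : X) \sum_(y : X) `|f x - f y| ^+ 2 * P x y * pi x.

Lemma sym_stationary P :
  (0 < #|X|)%N -> (forall x y, P x y = P y x) -> stochastic P ->
  stationary P unif.
Proof.
move=> X0 Psym [P0 P1]; split=> [x||y]; first by rewrite /unif invr_ge0.
- by rewrite sumr_const -[LHS]mulr_natr mulVf // pnatr_eq0 -lt0n.
- rewrite -mulr_sumr (eq_bigr (P y)) ?P1 ?mulr1 // => x _; exact: Psym.
Qed.

End Kernels.

Arguments unif : clear implicits.

(* 'Z_n is Z/nZ only for 1 < n, so every use assumes 2 < n. *)
Definition torus (n : nat) : finType := ('Z_n * 'Z_n)%type.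

Definition torus_step (n : nat) (x y : torus n) : bool :=
  (y == (x.1 + 1, x.2)) || (y == (x.1, x.2 + 1)).

Definition torus_adj (n : nat) (x y : torus n) : bool :=
  torus_step x y || torus_step y x.

Definition removed (n : nat) : {set torus n} :=
  [set x : torus n | [exists i : 'I_n, (1 <= i)%N && (x == (i%:R, i%:R))]] :|:
  [set x : torus n |
    [exists i : 'I_n, (1 <= i)%N && (x == (i%:R, i%:R + (n./2)%:R))]].

Definition kept (n : nat) : finType := {x : torus n | x \notin removed n}.

Definition lazy_walk (R : realType) (n : nat) (x y : torus n) : R :=
  if x == y then 1 / 2 else if torus_adj x y then 1 / 8 else 0.

Definition kept_deg (n : nat) (x : kept n) : nat :=
  #|[set y : kept n | torus_adj (val x) (val y)]|.

Definition mh_walk (R : realType) (n : nat) (x y : kept n) : R :=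
  if x == y then 1 - 1 / 8 * (kept_deg x)%:R
  else if torus_adj (val x) (val y) then 1 / 8 else 0.

Arguments lazy_walk : clear implicits.
Arguments mh_walk : clear implicits.

Lemma torus_adj_sym n (x y : torus n) : torus_adj x y = torus_adj y x.
Proof. by rewrite /torus_adj orbC. Qed.

Definition torus_nbrs n (x : torus n) : seq (torus n) :=
  [:: (x.1 + 1, x.2); (x.1, x.2 + 1); (x.1 - 1, x.2); (x.1, x.2 - 1)].

Lemma torus_adjE n (x y : torus n) : torus_adj x y = (y \in torus_nbrs x).
Proof.
case: x y => [a b] [c d].
rewrite /torus_adj /torus_step /torus_nbrs !inE /= !xpair_eqE.
rewrite [c == a - 1]eq_sym [d == b - 1]eq_sym !subr_eq.
by rewrite [b == d]eq_sym [a == c]eq_sym !orbA.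
Qed.

Lemma torus_nbrs_uniq n (x : torus n) : (2 < n)%N -> uniq (x :: torus_nbrs x).
Proof.
move=> n2.
have n1 : (1 : 'Z_n) == 0 = false by [].
have n0 : (1 + 1 : 'Z_n) == 0 = false.
  apply/eqP => /(congr1 val).
  by rewrite [LHS](val_Zp_nat (ltnW n2) 2) modn_small.
have e1 (a : 'Z_n) : (a + 1 == a) = false by rewrite -subr_eq0 addrAC subrr add0r.
have e2 (a : 'Z_n) : (a - 1 == a) = false.
  by rewrite -subr_eq0 addrAC subrr add0r oppr_eq0.
have e3 (a : 'Z_n) : (a + 1 == a - 1) = false.
  by rewrite -subr_eq0 opprB addrC addrA subrK.
case: x => a b; rewrite /= !inE !xpair_eqE /=.
by rewrite !(eq_sym a) !(eq_sym b) ?e1 ?e2 ?e3 ?eqxx ?andbF.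
Qed.

Lemma torus_card_gt0 n : (0 < #|torus n|)%N.
Proof. by apply/card_gt0P; exists (0, 0). Qed.

Lemma kept_card_gt0 n : (2 < n)%N -> (0 < #|kept n|)%N.
Proof.
move=> n2; have n1 := ltnW n2.
have k0 : (0, 0) \notin removed n.
  have nz (i : 'I_n) : (1 <= i)%N -> (0 == i%:R :> 'Z_n) = false.
    move=> i1; apply/eqP => /esym /(congr1 val).
    by rewrite [LHS](val_Zp_nat n1 i) modn_small //= => i0; rewrite i0 in i1.
  rewrite !inE negb_or; apply/andP; split; apply/existsP => -[i /andP[i1]];
    by rewrite xpair_eqE nz.
by apply/card_gt0P; exists (Sub (0, 0) k0).
Qed.

Lemma torus_adj_irr n (x : torus n) : (2 < n)%N -> torus_adj x x = false.
Proof.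
move=> n2; rewrite torus_adjE.
by have /= /andP[/negbTE] := torus_nbrs_uniq x n2.
Qed.

Lemma torus_deg n (x : torus n) :
  (2 < n)%N -> #|[set y : torus n | torus_adj x y]| = 4%N.
Proof.
move=> n2; have := torus_nbrs_uniq x n2; rewrite cons_uniq => /andP[_ u].
transitivity #|torus_nbrs x|; last exact: (card_uniqP u).
apply: eq_card => y.
by rewrite inE torus_adjE.
Qed.

Lemma kept_deg_le4 n (x : kept n) : (2 < n)%N -> (kept_deg x <= 4)%N.
Proof.
move=> n2; rewrite -(torus_deg (val x) n2) /kept_deg.
rewrite -(card_imset _ val_inj); apply/subset_leq_card/subsetP => y.
by case/imsetP=> z; rewrite !inE => xz ->.
Qed.

Lemma sum_adj (R : realType) (X : finType) (x : X) (c : R) (a : pred X) :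
  a x = false ->
  \sum_(y | y != x) (if x == y then c else if a y then 1 / 8 else 0) =
  1 / 8 * #|[set y | a y]|%:R :> R.
Proof.
move=> ax; rewrite (eq_bigr (fun y => if a y then 1 / 8 else 0 : R)); last first.
  by move=> y /negbTE; rewrite eq_sym => ->.
rewrite -big_mkcondr /= mulr_natr -sumr_const; apply: eq_bigl => y.
by rewrite inE; case: eqP => // ->; rewrite ax.
Qed.

Lemma lazy_walk_stationary (R : realType) n :
  (2 < n)%N -> stationary (lazy_walk R n) (unif R (torus n)).
Proof.
move=> n2; apply: sym_stationary; first exact: torus_card_gt0.
  by move=> x y; rewrite /lazy_walk eq_sym torus_adj_sym.
split=> [x y|x]; first by rewrite /lazy_walk; do 2?case: ifP => _ //; lra.
rewrite (bigD1 x) //= /lazy_walk eqxx sum_adj ?torus_adj_irr // torus_deg //.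
by lra.
Qed.

Lemma mh_walk_stationary (R : realType) n :
  (2 < n)%N -> stationary (mh_walk R n) (unif R (kept n)).
Proof.
move=> n2; apply: sym_stationary; first exact: kept_card_gt0.
  move=> x y; rewrite /mh_walk torus_adj_sym (eq_sym y).
  by case: eqP => // ->.
split=> [x y|x].
  have : (kept_deg x)%:R <= 4%:R :> R by rewrite ler_nat kept_deg_le4.
  by rewrite /mh_walk; do 2?case: ifP => _ //; lra.
rewrite (bigD1 x) //= /mh_walk eqxx.
rewrite (sum_adj _ (a := fun y => torus_adj (val x) (val y))) ?torus_adj_irr //.
by rewrite subrK.
Qed.

(* Main.v *)
(* Extend f to the removed points of each of the two diagonals by its value at
   the point (0, p), p = 0 or n/2, of that diagonal which was kept.  On either
   side of the diagonal a staircase in V starts at (0, p) and meets, after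
   2i - 1 and 2i + 1 steps, the two neighbours on that side of the removed point
   (i, p + i).  By Cauchy-Schwarz along the staircases, the four new edges at this
   point have total energy at most 8 i E, where E is the energy of f (sum over
   unordered edges).  Hence the extension has energy at most
   E + 8 n (n - 1) E <= 8 n^2 E, and passing from K to Q only gains the factor
   |G| / |V| >= 1.  The staircases avoid R when n > 4; for n = 4 the point (2, 3)
   is isolated in V, against irreducibility. *)
Require Import Defs.
From mathcomp Require Import all_boot all_order all_algebra.
From mathcomp Require Import reals.
From mathcomp Require Import ring lra zify.

Set Implicit Arguments.
Unset Strict Implicit.
Unset Printing Implicit Defensive.

Import Order.TTheory GRing.Theory Num.Theory.
Local Open Scope ring_scope.

(** * Comparison of sums, and Cauchy-Schwarz along a path *)

(** Repeated values of [g] only add nonnegative terms, so the two removed diagonals can be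
    parametrised without checking that they are disjoint. *)
Lemma ler_sum_cover (R : realType) (I J : finType) (A : {pred I})
    (B : {pred J}) (g : J -> I) (h : I -> R) :
  (forall x, 0 <= h x) -> (forall x, x \in A -> exists2 j, j \in B & g j = x) ->
  \sum_(x in A) h x <= \sum_(j in B) h (g j).
Proof.
move=> h0 cov; rewrite (partition_big g predT) //= [leLHS]big_mkcond.
apply: ler_sum => x _; case: ifP => [/cov[j Bj gj]|_]; last exact: sumr_ge0.
by rewrite (bigD1 j) ?Bj ?gj //= lerDl sumr_ge0.
Qed.

Lemma ler_sum_inj (R : realType) (I J : finType) (A : {pred I})
    (g : J -> I) (h : I -> R) :
  (forall x, 0 <= h x) -> injective g -> (forall j, g j \in A) ->
  \sum_j h (g j) <= \sum_(x in A) h x.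
Proof.
move=> h0 gI gA; rewrite -(big_imset (A := predT) h (in2W gI)) /= big_mkcond.
rewrite [leRHS]big_mkcond ler_sum // => x _.
by case: imsetP => [[j _ ->]|_]; [rewrite gA | case: ifP].
Qed.

Lemma sqr_telescope_le (R : realType) (u : nat -> R) m :
  (u m - u 0) ^+ 2 <= m%:R * \sum_(k < m) (u k.+1 - u k) ^+ 2.
Proof.
elim: m => [|m IH]; first by rewrite subrr expr0n mul0r.
rewrite big_ord_recr /=.
set S := \sum_(k < m) _ in IH *.
have S0 : 0 <= S by apply: sumr_ge0 => k _; exact: sqr_ge0.
have -> : u m.+1 - u 0 = (u m - u 0) + (u m.+1 - u m) by lra.
move: (u m - u 0) (u m.+1 - u m) IH => a b IH.
(* The step multiplies by the length [M], so length 0 is treated apart. For [M > 0] the difference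
   of the two sides times [M] is at least [(a - M * b) ^+ 2]. *)
case: m S S0 IH => [|m] S S0 IH.
  have a2 := sqr_ge0 a; have a0 : a ^+ 2 = 0 by lra.
  by move/eqP: a0; rewrite sqrf_eq0 => /eqP ->; lra.
rewrite -subr_ge0 -(pmulr_rge0 _ (ltr0Sn R m)).
rewrite [m.+2%:R]mulrS; move: IH (ltr0Sn R m); set M := m.+1%:R => IH M0.
have := sqr_ge0 (a - M * b); nra.
Qed.

(** * Edge energies and Dirichlet forms *)

(** Ordered pairs are summed, so every edge counts twice; hence the factors 2 below. *)
Definition edge_energy (R : realType) n (A : {pred torus n}) (F : torus n -> R) :=
  \sum_(x in A) \sum_(y in A | torus_adj x y) (F x - F y) ^+ 2.

Lemma edge_energy_ge0 (R : realType) n (A : {pred torus n}) (F : torus n -> R) :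
  0 <= edge_energy A F.
Proof. by apply: sumr_ge0 => x _; apply: sumr_ge0 => y _; exact: sqr_ge0. Qed.

Lemma dirichlet_lazy_walk (R : realType) n (F : torus n -> R) :
  dirichlet (lazy_walk R n) (unif R (torus n)) F =
  edge_energy predT F / (16 * #|torus n|%:R).
Proof.
rewrite /dirichlet /edge_energy /unif invfM; move: #|_|%:R^-1 => c.
rewrite mulrA !mulr_suml mulr_sumr.
apply: eq_bigr => x _.
rewrite !mulr_suml mulr_sumr [RHS]big_mkcond; apply: eq_bigr => y _ /=.
rewrite real_normK ?num_real // /lazy_walk.
case: (x =P y) => [->|_]; case: ifP => _; rewrite ?subrr ?expr0n /=; lra.
Qed.

(** Holding probabilities contribute nothing, and off the diagonal both kernels have weight 1/8;
    only the sizes of the two vertex sets distinguish the normalisations. *)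
Lemma dirichlet_mh_walk (R : realType) n (f : kept n -> R) (F : torus n -> R) :
  (forall x, F (val x) = f x) ->
  dirichlet (mh_walk R n) (unif R (kept n)) f =
  edge_energy [predC removed n] F / (16 * #|kept n|%:R).
Proof.
move=> Ff.
rewrite /dirichlet /edge_energy /unif invfM; move: #|_|%:R^-1 => c.
rewrite mulrA !mulr_suml mulr_sumr.
rewrite [RHS]big_sub; apply: eq_bigr => x _.
rewrite !mulr_suml mulr_sumr [RHS]big_sub_cond [RHS]big_mkcond.
apply: eq_bigr => y _ /=; rewrite !Ff.
rewrite real_normK ?num_real // /mh_walk.
case: (x =P y) => [->|_]; case: ifP => _; rewrite ?subrr ?expr0n /=; lra.
Qed.

Lemma path_energy_le (R : realType) n (A : {pred torus n}) (F : torus n -> R)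
    (v : nat -> torus n) m :
  {in [pred k | (k <= m)%N] &, injective v} ->
  (forall k, (k <= m)%N -> v k \in A) ->
  (forall k, (k < m)%N -> torus_adj (v k) (v k.+1)) ->
  2 * \sum_(k < m) (F (v k.+1) - F (v k)) ^+ 2 <= edge_energy A F.
Proof.
move=> vI vA vadj; rewrite /edge_energy pair_big_dep /=.
pose g (j : bool * 'I_m) := if j.1 then (v j.2.+1, v j.2) else (v j.2, v j.2.+1).
pose h (q : torus n * torus n) := (F q.1 - F q.2) ^+ 2.
have -> : 2 * \sum_(k < m) (F (v k.+1) - F (v k)) ^+ 2 = \sum_j h (g j).
  rewrite -(pair_bigA _ (fun b i => h (g (b, i)))) big_bool /= mulr2n mulrDl mul1r.
  by congr (_ + _); apply: eq_bigr => k _; rewrite /h /g //= -sqrrN opprB.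
apply: (ler_sum_inj (A := [pred q | (q.1 \in A) && ((q.2 \in A) && torus_adj q.1 q.2)])).
- by move=> q; exact: sqr_ge0.
- have vI' (k l : nat) : (k <= m)%N -> (l <= m)%N -> v k = v l -> k = l by move=> *; exact: vI.
  move=> [b i] [c j]; have := ltn_ord i; have := ltn_ord j.
  case: b c => -[] jm im /= [] => /vI' e /vI' e';
    move: (e ltac:(lia) ltac:(lia)) (e' ltac:(lia) ltac:(lia)) => {}e {}e'; try lia;
    by congr (_, _); apply: val_inj => /=; lia.
- move=> [b k] /=; have km := ltn_ord k.
  by case: b; rewrite inE /= !vA ?vadj ?(ltnW km) //= torus_adj_sym vadj.
Qed.

(** * The removed set, and the case n = 4 *)

Lemma Zn_nat_inj n a b :
  (1 < n)%N -> (a < n)%N -> (b < n)%N -> a%:R = b%:R :> 'Z_n -> a = b.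
Proof.
move=> n1 an bn /(congr1 (@nat_of_ord _)); rewrite !val_Zp_nat //.
by rewrite !modn_small.
Qed.

Lemma mem_removedP n (x : torus n) : (1 < n)%N -> ~~ odd n ->
  reflect (x.1 != 0 /\ (x.2 - x.1 = 0 \/ x.2 - x.1 = (n./2)%:R))
          (x \in removed n).
Proof.
move=> n1 nev; have natE (a : 'Z_n) : a = (a : nat)%:R.
  by apply/val_inj; rewrite /= (val_Zp_nat n1) modn_small // -{2}(Zp_cast n1).
apply: (iffP idP).
  have nz (i : 'I_n) : (1 <= i)%N -> (i%:R : 'Z_n) != 0.
    move=> i1; apply/eqP => /(Zn_nat_inj n1 (ltn_ord i) (ltnW n1)) i0.
    by rewrite i0 in i1.
  by rewrite !inE => /orP[] /existsP[i /andP[i1 /eqP->]] /=; split;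
    rewrite ?nz //; [left|right]; rewrite ?subrr // addrC addKr.
case: x => a b /= [a0 ab]; rewrite !inE.
have an : (a < n)%N by rewrite -{2}(Zp_cast n1).
have a1 : (1 <= a)%N.
  by rewrite lt0n; apply: contra_neq a0 => a0; apply: val_inj.
case: ab => ab; apply/orP; [left|right]; apply/existsP; exists (Ordinal an);
  by rewrite a1 /= -natE xpair_eqE eqxx /= -[b](subrK a) ab ?add0r // addrC.
Qed.

(** Doubling kills both 0 and n/2, so the two diagonals can be avoided by a single test. *)
Lemma removed_double n (x : torus n) : (1 < n)%N -> ~~ odd n ->
  x \in removed n -> x.1 != 0 /\ (x.2 - x.1) *+ 2 = 0.
Proof.
move=> n1 nev /(mem_removedP _ n1 nev)[x0 xd]; split=> //.
case: xd => ->; first by rewrite mul0rn.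
by rewrite -mulrnA muln2 even_halfK // pchar_Zp.
Qed.

Lemma notin_removed_fst0 n (d : 'Z_n) :
  (1 < n)%N -> ~~ odd n -> (0, d) \notin removed n.
Proof. by move=> n1 nev; apply/negP => /(removed_double n1 nev)[/eqP]. Qed.

Lemma kernel_isolated (R : realType) n (x : kept n) k (y : kept n) :
  (forall z : kept n, ~~ torus_adj (val x) (val z)) ->
  x != y -> kpow (mh_walk R n) k x y = 0.
Proof.
move=> iso xy; elim: k => [|k IH] /=; first by rewrite (negbTE xy).
apply: big1 => z _; rewrite /mh_walk.
by case: eqP => [<-|_]; rewrite ?IH ?mulr0 // (negbTE (iso z)) mul0r.
Qed.

Lemma mh_walk4_reducible (R : realType) : ~ irreducible_kernel (mh_walk R 4).
Proof.
have k0 : ((0, 0) : torus 4) \notin removed 4 by exact: notin_removed_fst0.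
have k1 : ((2, 3) : torus 4) \notin removed 4.
  by apply/negP => /(elimT (mem_removedP _ (isT : (1 < 4)%N) isT))[_ []].
move=> /(_ (Sub (2, 3) k1) (Sub (0, 0) k0))[k].
rewrite kernel_isolated ?ltxx // => -[z zk] /=.
apply/negP; rewrite torus_adjE !inE /= => /or4P[] /eqP zE.
(* The neighbours (3,3), (2,0), (1,3), (2,2) have coordinate differences 0, 2, 2, 0 modulo 4. *)
all: move/negP: zk; apply; rewrite zE.
all: apply: (introT (mem_removedP _ (isT : (1 < 4)%N) isT)); split=> //=.
all: by [left; apply/val_inj | right; apply/val_inj].
Qed.

(** * Staircases beside a removed diagonal *)

(* Two steps in one coordinate, then alternately one in each, so that the walk
   runs along the diagonals at distance 1 and 2 from the removed one; [s] selects
   the side.  Truncation ([0.-1 = 0]) gives the start (0, p). *)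
Definition stair n (s : bool) (p : 'Z_n) (k : nat) : torus n :=
  let b := k.-1./2 in
  if s then ((k - b)%:R, p + b%:R) else (b%:R, p + (k - b)%:R).

Lemma stair0 n s (p : 'Z_n) : stair s p 0 = (0, p).
Proof. by rewrite /stair; case: s; rewrite /= addr0. Qed.

Lemma stair_adj n s (p : 'Z_n) k : torus_adj (stair s p k) (stair s p k.+1).
Proof.
have nbr (a b : 'Z_n) : torus_adj (a, b) (a + 1, b) && torus_adj (a, b) (a, b + 1).
  by rewrite !torus_adjE !inE /= !eqxx /= orbT.
(* Either [k.-1./2] stays and the other coordinate advances, or it grows by one and the other stays.
   Truncation puts both [k = 0] and [k = 1] in the first case. *)
have [hk|hk] : (k./2 = k.-1./2 \/ k.-1./2.+1 = k./2 /\ (0 < k)%N)%N by lia.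
  have -> : stair s p k.+1 = let: x := stair s p k in
     if s then (x.1 + 1, x.2) else (x.1, x.2 + 1).
    rewrite /stair /= hk subSn; last by lia.
    by case: s; rewrite mulrSr ?addrA.
  by case: s; case: (stair _ _ _) => a b; have /andP[] := nbr a b.
have -> : stair s p k.+1 = let: x := stair s p k in
     if s then (x.1, x.2 + 1) else (x.1 + 1, x.2).
  rewrite /stair /= -hk.1 subSS.
  by case: s; rewrite [_.+1%:R]mulrSr ?addrA.
by case: s; case: (stair _ _ _) => a b; have /andP[] := nbr a b.
Qed.

(** Up to time 2n - 1, the longest staircase needed, [k.-1./2] stays below n and can be read off
    modulo n; the remainder [k - k.-1./2.*2] is at most 2. *)
Lemma stair_inj n s (p : 'Z_n) : (2 < n)%N ->
  {in [pred k | (k <= n.*2.-1)%N] &, injective (stair s p)}.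
Proof.
move=> n2 k l; rewrite !inE => kn ln e.
have n1 := ltnW n2.
have [eb ed] : k.-1./2%:R = l.-1./2%:R :> 'Z_n /\
    (k - k.-1./2)%:R = (l - l.-1./2)%:R :> 'Z_n.
  have := congr1 snd e; have := congr1 fst e; rewrite /stair.
  by case: (s) => /= e1 /addrI e2.
have {}eb : k.-1./2 = l.-1./2 by apply: (Zn_nat_inj n1 _ _ eb); lia.
have splitk j : (j - j.-1./2 = j.-1./2 + (j - j.-1./2.*2))%N by lia.
move: ed; rewrite (splitk k) (splitk l) eb !natrD => /addrI ed.
have := Zn_nat_inj n1 _ _ ed; lia.
Qed.

Lemma stair_kept n s (p : 'Z_n) k : (4 < n)%N -> ~~ odd n -> p *+ 2 = 0 ->
  stair s p k \notin removed n.
Proof.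
move=> n4 nev p2; have n1 : (1 < n)%N by lia.
case: k => [|k]; first by rewrite stair0 notin_removed_fst0.
apply/negP => /(removed_double n1 nev)[_].
set b := k./2; set d := (k.+1 - b.*2)%N.
have kb : (k.+1 - b = b + d)%N by lia.
have d0 : (0 < d <= 2)%N by lia.
(* After time 0 the coordinate difference is [p] plus or minus [d]; its double is plus or minus
   [2 * d], nonzero because [2 * d <= 4 < n]. *)
have dn : d%:R *+ 2 != 0 :> 'Z_n.
  rewrite -mulrnA; apply/eqP => /(@Zn_nat_inj n (d * 2) 0 n1); lia.
rewrite /stair /= -/b kb natrD; case: s => /= e.
  move: dn; rewrite -[_ *+ 2]opprK -mulNrn.
  have -> : - d%:R = (p + b%:R - (b%:R + d%:R)) - p by ring.
  by rewrite mulrnBl e p2 subr0 oppr0 eqxx.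
move: dn; have -> : d%:R = (p + (b%:R + d%:R) - b%:R) - p :> 'Z_n by ring.
by rewrite mulrnBl e p2 subr0 eqxx.
Qed.

Lemma stair_odd n s (p : 'Z_n) i :
  stair s p i.*2.+1 = if s then (i.+1%:R, p + i%:R) else (i%:R, p + i.+1%:R).
Proof.
rewrite /stair succnK doubleK.
by have -> : (i.*2.+1 - i = i.+1)%N by lia.
Qed.

Lemma stair_energy_le (R : realType) n (F : torus n -> R) s (p : 'Z_n) m :
  (4 < n)%N -> ~~ odd n -> p *+ 2 = 0 -> (m <= n.*2.-1)%N ->
  (F (0, p) - F (stair s p m)) ^+ 2 <=
  m%:R * (edge_energy [predC removed n] F / 2).
Proof.
move=> n4 nev p2 mn; rewrite -sqrrN opprB -[X in _ - F X](stair0 s).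
apply: le_trans (sqr_telescope_le (F \o stair s p) m) _.
apply: ler_wpM2l => //; rewrite ler_pdivlMr // mulrC.
apply: path_energy_le => [k l km lm||].
- by apply: stair_inj; rewrite ?inE //; [lia|exact: leq_trans km mn|exact: leq_trans lm mn].
- by move=> k _; rewrite inE; exact: stair_kept.
- by move=> k _; exact: stair_adj.
Qed.

(** * Energy of the new edges *)

Lemma sum_nbrs_diag (R : realType) n (p : 'Z_n) i (h : torus n -> R) : (2 < n)%N ->
  \sum_(y | torus_adj (i.+1%:R, p + i.+1%:R) y) h y =
  h (stair true p i.*2.+1) + h (stair true p i.*2.+3) +
  (h (stair false p i.*2.+1) + h (stair false p i.*2.+3)).
Proof.
move=> n2; set x := (_, _).
have /andP[_ u] : uniq (x :: torus_nbrs x) by exact: torus_nbrs_uniq.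
rewrite (eq_bigl (mem (torus_nbrs x))); last by move=> y; rewrite torus_adjE.
rewrite -big_uniq // -doubleS !stair_odd /torus_nbrs !big_cons big_nil /=.
have -> : i.+1%:R - 1 = i%:R :> 'Z_n by rewrite mulrSr addrK.
have -> : i.+1%:R + 1 = i.+2%:R :> 'Z_n by rewrite [RHS]mulrSr.
have -> : p + i.+1%:R - 1 = p + i%:R by rewrite mulrSr addrA addrK.
have -> : p + i.+1%:R + 1 = p + i.+2%:R by rewrite -addrA -mulrSr.
ring.
Qed.

Lemma sum_nat_ord (R : realType) n : \sum_(i < n) i%:R = n%:R * (n%:R - 1) / 2 :> R.
Proof.
elim: n => [|n IH]; first by rewrite big_ord0 !mul0r.
by rewrite big_ord_recr /= IH mulrSr; field.
Qed.

Lemma sum_removed_le (R : realType) n (F : torus n -> R) :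
  (4 < n)%N -> ~~ odd n ->
  (forall x, x \in removed n -> F x = F (0, x.2 - x.1)) ->
  \sum_(x in removed n) \sum_(y | torus_adj x y) (F x - F y) ^+ 2 <=
  4 * n%:R * (n%:R - 1) * edge_energy [predC removed n] F.
Proof.
move=> n4 nev FE; set E := edge_energy _ _.
have n1 : (1 < n)%N by lia.
have E0 : 0 <= E by exact: edge_energy_ge0.
pose p (b : bool) : 'Z_n := if b then (n./2)%:R else 0.
have p2 b : p b *+ 2 = 0.
  by case: b => /=; rewrite ?mul0rn // -mulrnA muln2 even_halfK // pchar_Zp.
pose g (j : bool * 'I_n) : torus n := (j.2%:R, p j.1 + j.2%:R).
pose h x := \sum_(y | torus_adj x y) (F x - F y) ^+ 2.
apply: (@le_trans _ _ (\sum_(j in [pred j : bool * 'I_n | (0 < j.2)%N]) h (g j))).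
  apply: ler_sum_cover.
    by move=> x; apply: sumr_ge0 => y _; exact: sqr_ge0.
  move=> x; rewrite !inE => /orP[] /existsP[i /andP[i1 /eqP->]];
      [exists (false, i) | exists (true, i)] => //; rewrite /g /= ?add0r //.
  by rewrite addrC.
have gE (j : bool * 'I_n) : (0 < j.2)%N ->
    \sum_(y | torus_adj (g j) y) (F (g j) - F y) ^+ 2 <= j.2%:R * (4 * E).
  case: j => b [[//|i] ilt] /= _.
  have gr : g (b, Ordinal ilt) \in removed n.
    apply/mem_removedP => //=; split.
      by apply/eqP => /(@Zn_nat_inj n i.+1 0 n1 ilt); lia.
    by rewrite addrK; case: b; [right|left].
  rewrite /h (FE _ gr) /g /= addrK sum_nbrs_diag; last by lia.
  have st s m : (m <= n.*2.-1)%N -> _ := @stair_energy_le R n F s (p b) m n4 nev (p2 b).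
  have ea : (i.*2.+1 <= n.*2.-1)%N by lia.
  have eb : (i.*2.+3 <= n.*2.-1)%N by lia.
  have := st true _ ea; have := st true _ eb.
  have := st false _ ea; have := st false _ eb.
  have -> : i.*2.+1%:R = 2 * i%:R + 1 :> R by rewrite mulrSr -mul2n natrM.
  have -> : i.*2.+3%:R = 2 * i%:R + 3 :> R by rewrite -addn3 natrD -mul2n natrM.
  have -> : i.+1%:R = i%:R + 1 :> R by rewrite mulrSr.
  (* The four times [2 * i + 1], [2 * i + 3], each taken on both sides, add up to [8 * (i + 1)], and
     each is weighted by [E / 2]. *)
  by rewrite -/E; lra.
(* The added indices [j.2 = 0] contribute zero. *)
apply: (@le_trans _ _ (\sum_(j : bool * 'I_n) j.2%:R * (4 * E))).
  rewrite big_mkcond ler_sum // => j _; rewrite inE.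
  by case: ifP => [/gE//|_]; rewrite mulr_ge0 ?mulr_ge0.
rewrite -(pair_bigA _ (fun=> fun i : 'I_n => i%:R * (4 * E))) /= big_bool /=.
by rewrite -mulr_suml sum_nat_ord; lra.
Qed.

(** The ordered pairs that meet [A] start or end in [A]; reversal exchanges the two kinds, whence
    the factor 2. Pairs inside [A] may be overcounted. *)
Lemma edge_energy_predT_le (R : realType) n (A : {set torus n}) (F : torus n -> R) :
  edge_energy predT F <= edge_energy [predC A] F +
    2 * \sum_(x in A) \sum_(y | torus_adj x y) (F x - F y) ^+ 2.
Proof.
rewrite /edge_energy (bigID (mem A)) /= mulr2n mulrDl mul1r [leRHS]addrCA lerD //.
rewrite (eq_bigr (fun x => \sum_(y in [predC A] | torus_adj x y) (F x - F y) ^+ 2 +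
    \sum_(y in A | torus_adj x y) (F x - F y) ^+ 2)); last first.
  move=> x _; rewrite (bigID (mem [predC A])) /=.
  by congr (_ + _); apply: eq_bigl => y; rewrite !inE ?negbK andbC.
rewrite big_split lerD2l (exchange_big_dep (mem A)) /=; last by move=> x y _ /andP[].
apply: ler_sum => y _; rewrite [leRHS]big_mkcond [leLHS]big_mkcond /=.
apply: ler_sum => x _; rewrite torus_adj_sym -sqrrN opprB.
by case: (torus_adj y x); rewrite ?andbF //; case: ifP => _; rewrite ?sqr_ge0.
Qed.

Lemma extend_kept (R : realType) n (f : kept n -> R) : (1 < n)%N -> ~~ odd n ->
  exists F : torus n -> R, (forall x, F (val x) = f x) /\
    (forall x, x \in removed n -> F x = F (0, x.2 - x.1)).
Proof.
(* The line of slope 1 through [x] meets the column of first coordinate 0, which is entirely kept,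
   in [q x]. *)
move=> n1 nev; pose q (x : torus n) : kept n :=
  Sub (0, x.2 - x.1) (notin_removed_fst0 (x.2 - x.1) n1 nev).
exists (fun x => f (insubd (q x) x)); split=> x; first by rewrite valKd.
move=> xr; congr f; apply: val_inj.
by rewrite !val_insubd xr notin_removed_fst0.
Qed.

Theorem theorem6 (R : realType) (n : nat) (hn3 : (3 <= n)%N) (hneven : ~~ odd n)
    (hQ : irreducible_kernel (mh_walk R n)) (f : kept n -> R) :
  exists fhat : torus n -> R,
    (forall x : kept n, fhat (val x) = f x) /\
    dirichlet (lazy_walk R n) (unif R (torus n)) fhat
      <= 8 * (n%:R) ^+ 2 * dirichlet (mh_walk R n) (unif R (kept n)) f.
Proof.
have n4 : (4 < n)%N.
  rewrite ltn_neqAle; apply/andP; split; last by lia.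
  by apply/eqP => n4; move: hQ; rewrite -n4; exact: mh_walk4_reducible.
have n1 : (1 < n)%N by lia.
have [F [Ff FE]] := extend_kept f n1 hneven; exists F; split=> //.
rewrite dirichlet_lazy_walk (dirichlet_mh_walk Ff) mulrA.
set E := edge_energy [predC _] F.
have E0 : 0 <= E by exact: edge_energy_ge0.
have nR : 1 <= n%:R :> R by rewrite ler1n; lia.
apply: ler_pM.
- exact: edge_energy_ge0.
- by rewrite invr_ge0 mulr_ge0.
(* The total is at most [(1 + 8 * n * (n - 1)) * E], and [1 <= 8 * n]. *)
- apply: le_trans (edge_energy_predT_le (removed n) F) _.
  have := sum_removed_le n4 hneven FE; rewrite -/E; nra.
- rewrite lef_pV2 ?posrE ?mulr_gt0 ?ltr0n ?torus_card_gt0 ?kept_card_gt0 //.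
  by rewrite ler_pM2l ?ltr0n // ler_nat card_sub max_card.
Qed.
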